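(* For every set of formulas $\Gamma$ and formula $A$ of the language $\{{\sim},\wedge,\vee\}$: if $\Gamma\models_{\bf CNL^2_4}A$, then $\Gamma\vdash A$.
   Context: Formulas are built from a countable set of propositional variables using ${\sim}$ (unary) and $\wedge,\vee$ (binary). A {\bf CNL$^2_4$}-interpretation assigns each propositional variable a value in $\{\mathbf{1},\mathbf{i},\mathbf{j},\mathbf{0}\}$ and is extended to all formulas by the truth tables: ${\sim}\mathbf{1}=\mathbf{i}$, ${\sim}\mathbf{i}=\mathbf{0}$, ${\sim}\mathbf{j}=\mathbf{1}$, ${\sim}\mathbf{0}=\mathbf{j}$; $\wedge$: $\mathbf{1}\wedge x=x\wedge\mathbf{1}=x$, $\mathbf{0}\wedge x=x\wedge\mathbf{0}=\mathbf{0}$, $\mathbf{i}\wedge\mathbf{i}=\mathbf{i}$, $\mathbf{j}\wedge\mathbf{j}=\mathbf{j}$, $\mathbf{i}\wedge\mathbf{j}=\mathbf{j}\wedge\mathbf{i}=\mathbf{0}$; $\vee$: $\mathbf{1}\vee x=x\vee\mathbf{1}=\mathbf{1}$, $\mathbf{0}\vee x=x\vee\mathbf{0}=x$, $\mathbf{i}\vee\mathbf{i}=\mathbf{i}$, $\mathbf{j}\vee\mathbf{j}=\mathbf{j}$, $\mathbf{i}\vee\mathbf{j}=\mathbf{j}\vee\mathbf{i}=\mathbf{1}$. $\Gamma\models_{\bf CNL^2_4}A$ iff for every interpretation, if every $B\in\Gamma$ takes a value in $\mathcal{D}=\{\mathbf{1},\mathbf{i}\}$ then $A$ takes a value in $\mathcal{D}$.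 The natural deduction calculus has the rules: ($\wedge$I) from $A$ and $B$ infer $A\wedge B$; ($\wedge$E) from $A\wedge B$ infer $A$, and infer $B$; ($\vee$I) from $A$ infer $A\vee B$, from $B$ infer $A\vee B$; ($\vee$E) from $A\vee B$, a derivation of $C$ from the (discharged) assumption $A$, and a derivation of $C$ from the (discharged) assumption $B$, infer $C$; (${\sim}{\sim}1$) from $A$ and ${\sim}{\sim}A$ infer any $B$; (${\sim}{\sim}2$) infer $A\vee{\sim}{\sim}A$ from no premises; from ${\sim}A$ and ${\sim}B$ infer ${\sim}(A\wedge B)$; from ${\sim}(A\wedge B)$ infer ${\sim}A$, and infer ${\sim}B$; from ${\sim}A$ infer ${\sim}(A\vee B)$; from ${\sim}B$ infer ${\sim}(A\vee B)$; from ${\sim}(A\vee B)$, a derivation of $C$ from the (discharged) assumption ${\sim}A$, and a derivation of $C$ from the (discharged) assumption ${\sim}B$, infer $C$. $\Gamma\vdash A$ iff for some finite $\Gamma'\subseteq\Gamma$ there is a derivation of $A$ from $\Gamma'$ in this calculus. *)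

(* Defs.v *)
From Stdlib Require Import List.

Inductive formula : Type :=
| Var : nat -> formula
| Neg : formula -> formula
| And : formula -> formula -> formula
| Or : formula -> formula -> formula.

(* The truth values 1, i, j, 0. *)
Inductive value : Type := V1 | Vi | Vj | V0.

Definition neg_v (x : value) : value :=
  match x with
  | V1 => Vi
  | Vi => V0
  | Vj => V1
  | V0 => Vj
  end.

Definition and_v (x y : value) : value :=
  match x, y with
  | V1, z | z, V1 => z
  | V0, _ | _, V0 => V0
  | Vi, Vi => Vi
  | Vj, Vj => Vj
  | Vi, Vj | Vj, Vi => V0
  end.

Definition or_v (x y : value) : value :=
  match x, y with
  | V1, _ | _, V1 => V1
  | V0, z | z, V0 => z
  | Vi, Vi => Vi
  | Vj, Vj => Vj
  | Vi, Vj | Vj, Vi => V1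
  end.

Fixpoint eval (v : nat -> value) (A : formula) : value :=
  match A with
  | Var p => v p
  | Neg B => neg_v (eval v B)
  | And B C => and_v (eval v B) (eval v C)
  | Or B C => or_v (eval v B) (eval v C)
  end.

Definition designated (x : value) : Prop := x = V1 \/ x = Vi.

Definition entails (Gamma : formula -> Prop) (A : formula) : Prop :=
  forall v : nat -> value,
    (forall B, Gamma B -> designated (eval v B)) -> designated (eval v A).

(* [deriv L A]: there is a natural deduction derivation of [A] all of whose
   undischarged assumptions occur in the list [L].  An assumption discharged
   by a rule is consed onto the list of the corresponding subderivation; it
   may be used any number of times there, including none. *)
Inductive deriv : list formula -> formula -> Prop :=
| d_assumption L A : In A L -> deriv L A
| d_andI L A B : deriv L A -> deriv L B -> deriv L (And A B)
| d_andE1 L A B : deriv L (And A B) -> deriv L A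
| d_andE2 L A B : deriv L (And A B) -> deriv L B
| d_orI1 L A B : deriv L A -> deriv L (Or A B)
| d_orI2 L A B : deriv L B -> deriv L (Or A B)
| d_orE L A B C :
    deriv L (Or A B) -> deriv (A :: L) C -> deriv (B :: L) C -> deriv L C
| d_negneg1 L A B : deriv L A -> deriv L (Neg (Neg A)) -> deriv L B
| d_negneg2 L A : deriv L (Or A (Neg (Neg A)))
| d_negandI L A B :
    deriv L (Neg A) -> deriv L (Neg B) -> deriv L (Neg (And A B))
| d_negandE1 L A B : deriv L (Neg (And A B)) -> deriv L (Neg A)
| d_negandE2 L A B : deriv L (Neg (And A B)) -> deriv L (Neg B)
| d_negorI1 L A B : deriv L (Neg A) -> deriv L (Neg (Or A B))
| d_negorI2 L A B : deriv L (Neg B) -> deriv L (Neg (Or A B))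
| d_negorE L A B C :
    deriv L (Neg (Or A B)) ->
    deriv (Neg A :: L) C -> deriv (Neg B :: L) C -> deriv L C.

(* The finite subset of [Gamma] is represented by a list. *)
Definition provable (Gamma : formula -> Prop) (A : formula) : Prop :=
  exists L : list formula, (forall B, In B L -> Gamma B) /\ deriv L A.

(* Main.v *)
(** Write [d x] for "x is designated".  A truth value [x] is determined by the
    pair [(d x, d (~x))]; on these pairs conjunction and disjunction act
    componentwise, and negation sends [(a, b)] to [(b, not a)].  Moreover [~~]
    behaves as a classical negation in the calculus.  Suppose [Gamma] does not
    prove [A].  It can then be extended, without proving [A], so as to contain
    [l] or [~~l] for each literal [l] of the form [p] or [~p].  These choices
    define an interpretation, and by induction on [B] the extension proves [B]
    if [B] is designated and [~~B] otherwise.  Hence all of [Gamma] is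
    designated and [A] is not. *)

From Stdlib Require Import List Bool PeanoNat Classical ClassicalEpsilon.
Require Import Defs.

#[local] Hint Constructors deriv : core.
#[local] Hint Resolve in_eq : core.

(** * Weakening and derived rules for double negation *)

Lemma deriv_weaken L L' A : deriv L A -> incl L L' -> deriv L' A.
Proof.
  intros H; revert L'; induction H; intros L' HL; auto.
  - apply d_andE1 with B; auto.
  - apply d_andE2 with A; auto.
  - apply d_orE with A B; auto;
      [apply IHderiv2 | apply IHderiv3]; apply incl_cons; auto using incl_tl.
  - apply d_negneg1 with A; auto.
  - apply d_negandE1 with B; auto.
  - apply d_negandE2 with A; auto.
  - apply d_negorE with A B; auto;
      [apply IHderiv2 | apply IHderiv3]; apply incl_cons; auto using incl_tl.
Qed.

Lemma deriv_cons L A B : deriv L A -> deriv (B :: L) A.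
Proof. intros H; apply (deriv_weaken L); auto using incl_tl, incl_refl. Qed.

(** Contraposition for the classical negation: split on [A] or [Neg (Neg A)]; in the first case [B]
    and [Neg (Neg B)] explode. *)
Lemma deriv_refute L A B :
  deriv (A :: L) B -> deriv L (Neg (Neg B)) -> deriv L (Neg (Neg A)).
Proof.
  intros HB HnB; apply (d_orE L A (Neg (Neg A))).
  - apply d_negneg2.
  - apply d_negneg1 with B; auto using deriv_cons.
  - auto.
Qed.

(** Split on [Neg (Neg A)] or its own double negation; the first contradicts [A]. *)
Lemma deriv_negneg_intro L A : deriv L A -> deriv L (Neg (Neg (Neg (Neg A)))).
Proof.
  intros HA; apply (d_orE L (Neg (Neg A)) (Neg (Neg (Neg (Neg A))))).
  - apply d_negneg2.
  - apply d_negneg1 with A; auto using deriv_cons.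
  - auto.
Qed.

(** * Provability from sets of formulas *)

Lemma provable_assumption (G : formula -> Prop) A : G A -> provable G A.
Proof.
  intros HA; exists (A :: nil); split.
  - intros B [<- | []]; exact HA.
  - auto.
Qed.

Lemma provable_map2 (G : formula -> Prop) A B C :
  (forall L, deriv L A -> deriv L B -> deriv L C) ->
  provable G A -> provable G B -> provable G C.
Proof.
  intros H [L [HL HA]] [L' [HL' HB]]; exists (L ++ L'); split.
  - intros X HX; apply in_app_or in HX; destruct HX; auto.
  - apply H; [apply (deriv_weaken L) | apply (deriv_weaken L')];
      auto using incl_appl, incl_appr, incl_refl.
Qed.

Lemma provable_map (G : formula -> Prop) A B :
  (forall L, deriv L A -> deriv L B) -> provable G A -> provable G B.
Proof. intros H [L [HL HA]]; exists L; auto. Qed.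

Definition extend (G : formula -> Prop) (A B : formula) : Prop := G B \/ B = A.

(** The list of assumptions may contain [A] anywhere and repeatedly; all such occurrences collapse
    into the head. *)
Lemma provable_extend (G : formula -> Prop) A B :
  provable (extend G A) B ->
  exists L, (forall C, In C L -> G C) /\ deriv (A :: L) B.
Proof.
  intros [L [HL HB]].
  assert (exists L', (forall C, In C L' -> G C) /\ incl L (A :: L'))
    as [L' [HG Hi]].
  { clear HB; induction L as [|X L IH].
    - exists nil; split; [intros C [] | apply incl_nil_l].
    - destruct IH as [L' [HG Hi]]; [auto using in_cons |].
      destruct (HL X (in_eq _ _)) as [HX | ->].
      + exists (X :: L'); split.
        * intros C [<- | HC]; auto.
        * apply incl_cons; [simpl; auto |].
          intros C HC; specialize (Hi C HC); simpl in *; tauto.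
      + exists L'; split; [| apply incl_cons]; auto. }
  exists L'; split; [exact HG | exact (deriv_weaken _ _ _ HB Hi)].
Qed.

Lemma provable_cases (G : formula -> Prop) A B :
  provable (extend G A) B -> provable (extend G (Neg (Neg A))) B ->
  provable G B.
Proof.
  intros H1 H2.
  apply provable_extend in H1 as [L1 [HL1 H1]].
  apply provable_extend in H2 as [L2 [HL2 H2]].
  exists (L1 ++ L2); split.
  - intros C HC; apply in_app_or in HC; destruct HC; auto.
  - apply (d_orE _ A (Neg (Neg A))).
    + apply d_negneg2.
    + eapply deriv_weaken; [exact H1 |].
      apply incl_cons; auto using incl_tl, incl_appl, incl_refl.
    + eapply deriv_weaken; [exact H2 |].
      apply incl_cons; auto using incl_tl, incl_appr, incl_refl.
Qed.

(** * The Lindenbaum extension *)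

Fixpoint stage (f : nat -> formula) (A : formula) (G : formula -> Prop)
    (n : nat) : formula -> Prop :=
  match n with
  | 0 => G
  | S m =>
      let G' := stage f A G m in
      extend G'
        (if excluded_middle_informative (provable (extend G' (f m)) A)
         then Neg (Neg (f m)) else f m)
  end.

(** [Neg (Neg (f n))] is added only when adding [f n] would yield [A]; were it to yield [A] as well,
    [provable_cases] would give [A] one stage earlier. *)
Lemma stage_unprovable f A G n :
  ~ provable G A -> ~ provable (stage f A G n) A.
Proof.
  intros HG; induction n as [|n IH]; simpl; [exact HG |].
  destruct (excluded_middle_informative _) as [H | H]; [| exact H].
  intros H'; exact (IH (provable_cases _ _ _ H H')).
Qed.

Lemma stage_mono f A G m n B : m <= n -> stage f A G m B -> stage f A G n B.
Proof. induction 1; simpl; unfold extend; auto. Qed.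

(** Compactness: finitely many assumptions each enter at some stage, and since stages increase, the
    largest of these contains them all. *)
Lemma provable_stages f A G B :
  provable (fun X => exists n, stage f A G n X) B ->
  exists n, provable (stage f A G n) B.
Proof.
  intros [L [HL HB]].
  assert (exists n, forall X, In X L -> stage f A G n X) as [n Hn].
  { clear HB; induction L as [|X L IH].
    - exists 0; intros X [].
    - destruct IH as [n Hn]; [auto using in_cons |].
      destruct (HL X (in_eq _ _)) as [m Hm].
      exists (Nat.max m n); intros Y [<- | HY];
        eauto using stage_mono, Nat.le_max_l, Nat.le_max_r. }
  exists n, L; auto.
Qed.

Lemma lindenbaum (f : nat -> formula) G A :
  ~ provable G A ->
  exists D : formula -> Prop,
    (forall B, G B -> D B) /\ ~ provable D A /\
    (forall n, D (f n) \/ D (Neg (Neg (f n)))).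
Proof.
  intros HG; exists (fun X => exists n, stage f A G n X); repeat split.
  - intros B HB; exists 0; exact HB.
  - intros H; apply provable_stages in H as [n Hn].
    exact (stage_unprovable f A G n HG Hn).
  - intros n.
    destruct (excluded_middle_informative
                (provable (extend (stage f A G n) (f n)) A)) eqn:E;
      [right | left]; exists (S n); simpl; rewrite E; right; reflexivity.
Qed.

(** * The interpretation determined by the literals *)

Definition literal (n : nat) : formula :=
  if Nat.even n then Var (Nat.div2 n) else Neg (Var (Nat.div2 n)).

Lemma literal_even p : literal (2 * p) = Var p.
Proof. unfold literal; now rewrite Nat.even_even, Nat.div2_double. Qed.

Lemma literal_odd p : literal (S (2 * p)) = Neg (Var p).
Proof.
  unfold literal.
  now rewrite Nat.even_succ, Nat.odd_even, Nat.div2_succ_double.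
Qed.

Definition des (x : value) : bool :=
  match x with V1 | Vi => true | Vj | V0 => false end.

Lemma des_designated x : designated x <-> des x = true.
Proof.
  unfold designated; destruct x; simpl; split; auto;
    try discriminate; intros [H | H]; discriminate.
Qed.

(** The inverse of sending [x] to the pair of [des x] and [des (neg_v x)]. *)
Definition value_of (a b : bool) : value :=
  match a, b with
  | true, true => V1
  | true, false => Vi
  | false, true => Vj
  | false, false => V0
  end.

(** Syntactic counterpart of designation, phrased by provability because [D] need not be closed
    under deduction. *)
Definition decided (D : formula -> Prop) (b : bool) (A : formula) : Prop :=
  provable D (if b then A else Neg (Neg A)).

Lemma decided_negneg D b A :
  decided D b A -> decided D (negb b) (Neg (Neg A)).
Proof.
  destruct b; apply provable_map; simpl; auto using deriv_negneg_intro.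
Qed.

(** [C] is abstract because a negated conjunction obeys the rules of a conjunction of the negated
    components, so one argument serves both; [decided_disj] is set up likewise. *)
Lemma decided_conj D a b A B C :
  (forall L, deriv L A -> deriv L B -> deriv L C) ->
  (forall L, deriv L C -> deriv L A) ->
  (forall L, deriv L C -> deriv L B) ->
  decided D a A -> decided D b B -> decided D (a && b) C.
Proof.
  intros HI HE1 HE2; destruct a, b; apply provable_map2; intros L HA HB;
    simpl in *; auto.
  - apply deriv_refute with B; auto.
  - apply deriv_refute with A; auto.
  - apply deriv_refute with A; auto.
Qed.

Lemma decided_disj D a b A B C :
  (forall L, deriv L A -> deriv L C) ->
  (forall L, deriv L B -> deriv L C) ->
  (forall L X, deriv L C -> deriv (A :: L) X -> deriv (B :: L) X ->
    deriv L X) ->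
  decided D a A -> decided D b B -> decided D (a || b) C.
Proof.
  intros HI1 HI2 HE; destruct a, b; apply provable_map2; intros L HA HB;
    simpl in *; auto.
  (* Both [A] and [B] are refuted here. From [C] one derives [A]: directly in case [A], by explosion
     in case [B]. *)
  apply deriv_refute with A; [| exact HA].
  apply HE.
  - auto.
  - auto.
  - apply d_negneg1 with B; auto using deriv_cons.
Qed.

Lemma des_and x y : des (and_v x y) = des x && des y.
Proof. destruct x, y; reflexivity. Qed.

Lemma des_or x y : des (or_v x y) = des x || des y.
Proof. destruct x, y; reflexivity. Qed.

Lemma des_neg_and x y :
  des (neg_v (and_v x y)) = des (neg_v x) && des (neg_v y).
Proof. destruct x, y; reflexivity. Qed.

Lemma des_neg_or x y :
  des (neg_v (or_v x y)) = des (neg_v x) || des (neg_v y).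
Proof. destruct x, y; reflexivity. Qed.

Lemma des_neg_neg x : des (neg_v (neg_v x)) = negb (des x).
Proof. destruct x; reflexivity. Qed.

(** The claim for [Neg B] is carried through the induction because a negated conjunction or
    disjunction is decided by the negations of its components. *)
Lemma decided_eval D v :
  (forall p, decided D (des (v p)) (Var p)) ->
  (forall p, decided D (des (neg_v (v p))) (Neg (Var p))) ->
  forall B, decided D (des (eval v B)) B /\
            decided D (des (neg_v (eval v B))) (Neg B).
Proof.
  intros HV HN B; induction B as [p | B [IH IHn] | B [IHB IHBn] C [IHC IHCn]
                                 | B [IHB IHBn] C [IHC IHCn]]; simpl.
  - auto.
  - split; [exact IHn |].
    rewrite des_neg_neg; apply decided_negneg; exact IH.
  - rewrite des_and, des_neg_and; split.
    + apply decided_conj with B C; eauto.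
    + apply decided_conj with (Neg B) (Neg C); eauto.
  - rewrite des_or, des_neg_or; split.
    + apply decided_disj with B C; eauto.
    + apply decided_disj with (Neg B) (Neg C); eauto.
Qed.

Lemma decided_interpretation (D : formula -> Prop) :
  (forall n, D (literal n) \/ D (Neg (Neg (literal n)))) ->
  exists v, forall B, decided D (des (eval v B)) B.
Proof.
  intros HD.
  set (bit := fun A => if excluded_middle_informative (D A)
                       then true else false).
  assert (Hbit : forall n, decided D (bit (literal n)) (literal n)).
  { intros n; unfold bit, decided.
    (* When the literal is not in [D], [HD] puts its double negation there. *)
    destruct (excluded_middle_informative _); apply provable_assumption;
      destruct (HD n); tauto. }
  exists (fun p => value_of (bit (Var p)) (bit (Neg (Var p)))).
  intros B; apply decided_eval; intros p.
  - specialize (Hbit (2 * p)); rewrite literal_even in Hbit.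
    (* Once both bits are known, [des] of [value_of] computes to the first bit; below, [neg_v]
       exposes the second. *)
    destruct (bit (Var p)), (bit (Neg (Var p))); exact Hbit.
  - specialize (Hbit (S (2 * p))); rewrite literal_odd in Hbit.
    destruct (bit (Var p)), (bit (Neg (Var p))); exact Hbit.
Qed.

Theorem mainTheorem2 (Gamma : formula -> Prop) (A : formula) :
  entails Gamma A -> provable Gamma A.
Proof.
  intros HA; apply NNPP; intros HG.
  destruct (lindenbaum literal Gamma A HG) as [D [HGD [HDA HD]]].
  destruct (decided_interpretation D HD) as [v Hv].
  assert (HvA : des (eval v A) = true).
  { apply des_designated, HA; intros B HB; apply des_designated.
    specialize (Hv B); destruct (des (eval v B)); [reflexivity | exfalso].
    (* An undesignated [B] in [Gamma] would let [D] prove both [B] and [Neg (Neg B)], hence [A]. *)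
    apply HDA; revert Hv; apply (provable_map2 D B (Neg (Neg B)) A).
    - intros L; apply d_negneg1.
    - apply provable_assumption; auto. }
  specialize (Hv A); rewrite HvA in Hv; exact (HDA Hv).
Qed.
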